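(* Let $h>0$ and $\xi\in\mathbb R$, and let $f_{\xi;\ell}$, $\ell=0,\dots,r$, be the coefficients of the SIAC spline kernel of degree $k$ and reproduction degree $r$ with index sequence $\mathcal J=(j_0,\dots,j_r)$ and knot sequence $ht_{0:n}+\xi$, where $f_{\xi;\ell}$ is the coefficient of $B(\cdot\,|\,ht_{j_\ell:j_\ell+k+1}+\xi)$. If the knots $t_0,\dots,t_n$ are rational, then the coefficients $f_{\xi;\ell}$ are polynomials in $\xi$ and $h^{-1}$ with rational coefficients.
   Context: Notation: $t_{i:j}=(t_i,\dots,t_j)$. For a non-decreasing sequence $t_{i:j}$ and sufficiently smooth $g$, divided differences are $\Delta(t_i)g=g(t_i)$ and, for $j>i$, $\Delta(t_{i:j})g=(\Delta(t_{i+1:j})g-\Delta(t_{i:j-1})g)/(t_j-t_i)$ if $t_i\ne t_j$, and $=g^{(j-i)}(t_i)/(j-i)!$ if $t_i=t_j$. B-spline: for knots $t_i\le\dots\le t_{i+k+1}$ with $t_i<t_{i+k+1}$, $B(x\,|\,t_{i:i+k+1}):=(k+1)\,\Delta(t_{i:i+k+1})\big(\max\{\cdot-x,0\}\big)^k$, the B-spline of degree $k$ with unit integral (values at knots are immaterial). SIAC spline kernel: let $\mathcal J=(j_0,\dots,j_r)$ be strictly increasing integers with $j_0=0$, let $n=j_r+k+1$, and let $t_{0:n}$ be non-decreasing real knots with $t_j<t_{j+k+1}$ for $j\in\mathcal J$. The SIAC spline kernel of degree $k$ and reproduction degree $r$ with index sequence $\mathcal J$ and knots $t_{0:n}$ is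 the spline $f=\sum_{\ell=0}^r f_{\ell}\,B(\cdot\,|\,t_{j_\ell:j_\ell+k+1})$ whose coefficients are such that $\big(f*(-\cdot)^\delta\big)(x)=(-x)^\delta$ for all $x\in\mathbb R$, $\delta=0,\dots,r$, where $(f*g)(x)=\int_{\mathbb R} f(t)g(x-t)\,\mathrm dt$. *)

(* Defs.v *)
From HB Require Import structures.
From mathcomp Require Export all_boot all_order all_algebra.
From mathcomp Require Export all_classical all_reals all_analysis.

Set Implicit Arguments.
Unset Strict Implicit.
Unset Printing Implicit Defensive.

Import Order.TTheory GRing.Theory Num.Theory.
Import numFieldNormedType.Exports.

Local Open Scope classical_set_scope.
Local Open Scope ring_scope.

Section Siac.
Context {R : realType}.
Implicit Types (t : nat -> R) (f g : R -> R).

(* [ddiff t i m g] is $\Delta(t_{i:i+m}) g$. *)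
Fixpoint ddiff t (i m : nat) g : R :=
  match m with
  | 0 => g (t i)
  | m'.+1 =>
    if t i == t (i + m)%N then (derive1n m g) (t i) / (m`!)%:R
    else (ddiff t i.+1 m' g - ddiff t i m' g) / (t (i + m)%N - t i)
  end.

(* $(\max\{y,0\})^k$, read for $k = 0$ as the Heaviside function: the power
   [Num.max y 0 ^+ 0] would be 1 everywhere because $0^0 = 1$ in MathComp. *)
Definition tpow (k : nat) (y : R) : R := if 0 < y then y ^+ k else 0.

(* $B(x | t_{i:i+k+1})$. At a knot of high multiplicity the derivative in
   [ddiff] may fail to exist; these finitely many values of $x$ are
   irrelevant to the integrals below. *)
Definition bspline (k : nat) t (i : nat) (x : R) : R :=
  k.+1%:R * ddiff t i k.+1 (fun y => tpow k (y - x)).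

Definition convolution f g (x : R) : R :=
  \int[lebesgue_measure]_(y in setT) (f y * g (x - y)).

Definition siac_spline (k r : nat) (J : 'I_r.+1 -> nat) t
    (c : 'I_r.+1 -> R) (x : R) : R :=
  \sum_(l < r.+1) c l * bspline k t (J l) x.

Definition siac_coefficients (k r : nat) (J : 'I_r.+1 -> nat) t
    (c : 'I_r.+1 -> R) : Prop :=
  forall d : nat, (d <= r)%N -> forall x : R,
    convolution (siac_spline k J t c) (fun y => (- y) ^+ d) x = (- x) ^+ d.

(* The value at (x, y) of a rational polynomial in two variables; x is
   substituted for the outer variable. *)
Definition ratpoly2_eval (p : {poly {poly rat}}) (x y : R) : R :=
  (map_poly (map_poly (ratr : rat -> R)) p).[x%:P].[y].

End Siac.

(* Main.v *)
Require Import Defs.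
From mathcomp Require Import perm measurable_realfun ring lra zify.
Import Order.TTheory GRing.Theory Num.Theory.
Import numFieldNormedType.Exports.
Local Open Scope ring_scope.

Set Implicit Arguments.
Unset Strict Implicit.

(** The reproduction condition may be read at a single abscissa.  Write the
    knots as [h * t_j + xi] with [t_j] rational, pick a rational [a] below all
    [t_j] and put [A = h * a + xi].  At [x = A] the condition of degree [d] says
    that the kernel has moment [(- A) ^+ d] about [A].

    The moments of a single B-spline about a point [A] below its knots [s_j] are
    explicit: the B-spline is a divided difference of truncated powers, and
    integrating a truncated power against [(x - A) ^+ d] is a beta integral, so
    the moment is a divided difference of [(y - A) ^+ (d + k + 1)] divided by
    ['C(d + k + 1, d)] ([bspline_moment]).  Divided differences of monomials are
    homogeneous polynomials in the knots, here in [s_j - A = h * (t_j - a)].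
    After cancelling [h ^+ d], the coefficients therefore solve a linear system
    whose matrix is rational and independent of [h] and [xi], and whose
    right-hand side is ['C(d + k + 1, d) * (- (xi / h) - a) ^+ d]
    ([siac_linear_system]).  Its solution is polynomial in [xi] and [h^-1] with
    rational coefficients as soon as the matrix is invertible.

    Invertibility ([det_moment_gt0]) is the positivity of the determinant of the
    divided differences [Delta(t_(J l) .. t_(J l + m)) y ^ (d + m)].  Its first
    column consists of ones.  Subtracting consecutive rows and telescoping along
    the indices between [J l] and [J (l + 1)], with the recursion of divided
    differences, writes it as a sum of determinants of the same kind, of size one
    less and order [m + 1], with weights [t_(i + m + 1) - t_i >= 0]
    ([det_moment_rec]).  By induction all these determinants are nonnegative, and
    the term that selects [i = J l] throughout is positive.  This works for
    arbitrary knot multiplicities. *)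

(** * Divided differences of monomials *)

(** [ddiff_mon t N i m] is the divided difference of [y ^+ N] at the knots
    [t i, .., t (i + m)], that is, the complete homogeneous symmetric polynomial
    of degree [N - m] in these knots (0 if [N < m]).  The recursion is the
    Leibniz rule for [y * y ^+ N]; it involves no division, so repeated knots
    need no special treatment and any commutative ring will do. *)
Fixpoint ddiff_mon (A : comNzRingType) (t : nat -> A) (N i m : nat) : A :=
  match N with
  | 0 => (m == 0%N)%:R
  | N'.+1 => t i * ddiff_mon t N' i m
             + (if m is m'.+1 then ddiff_mon t N' i.+1 m' else 0)
  end.

Section MonomialDifferences.
Context {A : comNzRingType}.
Implicit Type t : nat -> A.

(** The definition peels off the first knot; by symmetry the last one can be
    peeled off instead. Comparing both gives the difference quotient below. *)
Lemma ddiff_mon_recr t N i m :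
  ddiff_mon t N.+1 i m = t (i + m)%N * ddiff_mon t N i m
                      + (if m is m'.+1 then ddiff_mon t N i m' else 0).
Proof.
elim: N i m => [|N IH] i m.
  by case: m => [|[|m]] /=; rewrite ?addn0 ?mulr0 ?mulr1 ?addr0.
rewrite [LHS]/= -/(ddiff_mon t N.+1 i m).
case: m => [|m]; first by rewrite addn0.
rewrite [in LHS]IH [X in _ + X]IH.
rewrite [X in _ = _ * X + _]/= [X in _ = _ + X]/= addnS addSn.
by case: m => [|m]; ring.
Qed.

Lemma ddiff_mon_diff t N i m :
  ddiff_mon t N i.+1 m - ddiff_mon t N i m
    = (t (i + m.+1)%N - t i) * ddiff_mon t N i m.+1.
Proof.
have E := ddiff_mon_recr t N i m.+1; rewrite /= in E.
suff -> : ddiff_mon t N i.+1 m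
  = t (i + m.+1)%N * ddiff_mon t N i m.+1 + ddiff_mon t N i m
    - t i * ddiff_mon t N i m.+1 by ring.
by rewrite -E; ring.
Qed.

Lemma ddiff_mon_small t N i m : (N < m)%N -> ddiff_mon t N i m = 0.
Proof.
elim: N i m => [|N IH] i [|m] //= Nm.
by rewrite !IH ?mulr0 ?addr0 //; lia.
Qed.

Lemma ddiff_mon_self t m i : ddiff_mon t m i m = 1.
Proof.
elim: m i => [//|m IH] i /=.
by rewrite IH ddiff_mon_small // mulr0 add0r.
Qed.

Lemma ddiff_mon0 t N i : ddiff_mon t N i 0 = t i ^+ N.
Proof. by elim: N => [//|N IH] /=; rewrite IH addr0 exprS. Qed.

Lemma ddiff_mon_const t N i m (x : A) :
  (forall j, (i <= j <= i + m)%N -> t j = x) ->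
  ddiff_mon t N i m = 'C(N, m)%:R * x ^+ (N - m).
Proof.
elim: N i m => [|N IH] i m tx.
  by case: m tx => [|m] _ /=; rewrite ?mul1r ?mul0r.
rewrite /= tx ?leqnn ?leq_addr // (IH i m) //.
case: m tx => [|m] tx; first by rewrite !bin0 !subn0 addr0 !mul1r exprS.
rewrite (IH i.+1 m); last by move=> j ij; apply: tx; lia.
rewrite binS subSS natrD; have [Nm|mN] := leqP N m.
  by rewrite (@bin_small N m.+1) // mul0r mulr0 !add0r.
by rewrite (_ : (N - m)%N = (N - m.+1).+1) ?exprS; [ring|lia].
Qed.

Lemma ddiff_mon_scale (h : A) t N i m :
  h ^+ m * ddiff_mon (fun j => h * t j) N i m = h ^+ N * ddiff_mon t N i m.
Proof.
elim: N i m => [|N IH] i [|m] //=; first by rewrite !mulr0.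
  by rewrite !addr0 mulrCA IH exprS; ring.
transitivity (h * t i * (h ^+ m.+1 * ddiff_mon (fun j => h * t j) N i m.+1)
  + h * (h ^+ m * ddiff_mon (fun j => h * t j) N i.+1 m)).
  by rewrite !exprS; ring.
by rewrite !IH exprS; ring.
Qed.

End MonomialDifferences.

Lemma ddiff_mon_morph (A B : comNzRingType) (f : {rmorphism A -> B})
    (t : nat -> A) N i m :
  f (ddiff_mon t N i m) = ddiff_mon (f \o t) N i m.
Proof.
elim: N i m => [|N IH] i m /=; first by rewrite rmorph_nat.
by rewrite rmorphD rmorphM IH; case: m => [|m]; rewrite ?rmorph0 ?IH.
Qed.

(** * Positivity of the moment determinant *)

Section Determinant.
Context {F : realDomainType}.
Variable t : nat -> F.
Hypothesis t_mono : forall i j, (i <= j)%N -> t i <= t j.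

Definition moment_mx r (J : 'I_r -> nat) m : 'M[F]_r :=
  \matrix_(l, d) ddiff_mon t (d + m) (J l) m.

(** With a first column of ones, differencing consecutive rows clears that
    column below its top entry and so lowers the size by one. *)
Lemma det_row_diff (B : comNzRingType) r (M : 'M[B]_r.+1) :
  (forall l, M l ord0 = 1) ->
  \det M = \det (\matrix_(l < r, d < r)
    (M (lift ord0 l) (lift ord0 d) - M (widen_ord (leqnSn r) l) (lift ord0 d))).
Proof.
move=> M1.
(* Row [l] of [D *m M] is row [l] of [M] minus row [l - 1] (row 0 is kept). *)
pose D : 'M[B]_r.+1 := \matrix_(a, b) ((a == b)%:R - (val a == b.+1)%:R).
have detD : \det D = 1.
  rewrite det_trig.
    apply: big1 => a _; rewrite mxE eqxx.
    by rewrite ltn_eqF ?subr0.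
  apply/is_trig_mxP => a b ab; rewrite mxE.
  have -> : (a == b) = false by apply/eqP => ab'; rewrite ab' ltnn in ab.
  by rewrite (_ : (val a == b.+1) = false) ?subr0 //; apply/eqP => /=; lia.
have D0 b : (D *m M) ord0 b = M ord0 b.
  rewrite mxE (bigD1 ord0) //= big1 ?addr0 ?mxE ?eqxx ?subr0 ?mul1r //.
  by move=> a a0; rewrite mxE eq_sym (negPf a0) /= subr0 mul0r.
have DS l b : (D *m M) (lift ord0 l) b
    = M (lift ord0 l) b - M (widen_ord (leqnSn r) l) b.
  rewrite mxE (bigD1 (lift ord0 l)) //=.
  rewrite (bigD1 (widen_ord (leqnSn r) l)) //=; last first.
    by apply/eqP => /(congr1 val) /=; rewrite /bump /=; lia.
  rewrite big1 ?addr0.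
    rewrite !mxE eqxx /= /bump /= !add1n eqxx.
    rewrite (_ : (l.+1 == l.+2) = false) ?subr0 ?mul1r; last by apply/eqP; lia.
    rewrite (_ : (_ == widen_ord _ _) = false) ?sub0r ?mulN1r //.
    by apply/eqP => /(congr1 val) /=; rewrite /bump /=; lia.
  move=> a /andP[a1 a2]; rewrite mxE eq_sym (negPf a1) /= /bump /= add1n eqSS.
  rewrite (_ : (val l == val a) = false) ?subrr ?mul0r //.
  by apply/eqP => la; case/eqP: a2; apply: val_inj.
rewrite -[LHS]mul1r -detD -det_mulmx (expand_det_col _ ord0) big_ord_recl.
rewrite D0 M1 mul1r.
rewrite big1 ?addr0 => [|l _]; last by rewrite DS !M1 subrr mul0r.
rewrite /cofactor /= expr0 mul1r; congr (\det _); apply/matrixP => l d.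
by rewrite !mxE -[RHS]DS mxE.
Qed.

(** Multilinearity in all rows at once: choosing one summand in every row
    amounts to choosing a function [I]. *)
Lemma det_sum_rows (B : comNzRingType) r N (Q : 'I_r -> pred 'I_N)
    (w : 'I_N -> B) (v : 'I_N -> 'I_r -> B) :
  \det (\matrix_(l < r, d < r) \sum_(i | Q l i) w i * v i d)
  = \sum_(I in family Q) (\prod_l w (I l)) * \det (\matrix_(l, d) v (I l) d).
Proof.
rewrite /determinant.
transitivity (\sum_(s : 'S_r) \sum_(I in family Q)
   (-1) ^+ s * ((\prod_l w (I l)) * \prod_l v (I l) (s l))).
  apply: eq_bigr => s _; rewrite -mulr_sumr; congr (_ * _).
  under eq_bigr do rewrite mxE.
  by rewrite bigA_distr_big_dep; apply: eq_bigr => I _; rewrite -big_split.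
rewrite exchange_big /=; apply: eq_bigr => I _; rewrite mulr_sumr.
apply: eq_bigr => s _; rewrite mulrCA; congr (_ * (_ * _)).
by apply: eq_bigr => l _; rewrite mxE.
Qed.

(** The ranges [J l <= i < J (l + 1)] are consecutive intervals, so that choosing
    one index in each yields a strictly increasing sequence again. *)
Definition gap r (J : 'I_r.+1 -> nat) (l : 'I_r) : pred 'I_(J ord_max) :=
  fun i => (J (widen_ord (leqnSn r) l) <= i < J (lift ord0 l))%N.
Arguments gap {r} J l i /.

(** The difference of rows [l + 1] and [l] telescopes over the indices from [J l]
    to [J (l + 1)], each step being a divided difference of order one higher. *)
Lemma det_moment_rec r (J : 'I_r.+1 -> nat) m :
  (forall a b : 'I_r.+1, (a < b)%N -> (J a < J b)%N) ->
  \det (moment_mx J m)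
  = \sum_(I in family (gap J))
      (\prod_l (t (I l + m.+1)%N - t (I l)))
      * \det (moment_mx (fun l => val (I l)) m.+1).
Proof.
move=> Jinc.
rewrite det_row_diff => [|l]; last by rewrite mxE ddiff_mon_self.
rewrite -(det_sum_rows (gap J) (fun i => t (i + m.+1)%N - t i)
  (fun i d => ddiff_mon t (d + m.+1) i m.+1)).
congr (\det _); apply/matrixP => l d; rewrite !mxE /=.
set a := J (widen_ord _ _); set b := J (lift ord0 l).
have ab : (a < b)%N by apply: Jinc; rewrite /= /bump /=; lia.
have bM : (b <= J ord_max)%N.
  case: (ltngtP (val (lift ord0 l)) r) => h.
  - by apply/ltnW/Jinc.
  - by have := ltn_ord (lift ord0 l); rewrite ltnS leqNgt h.
  - by rewrite /b (_ : lift ord0 l = ord_max) //; apply: val_inj.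
have row i : (a <= i < b)%N ->
    (t (i + m.+1)%N - t i) * ddiff_mon t (d + m.+1) i m.+1
    = ddiff_mon t (bump 0 d + m) i.+1 m - ddiff_mon t (bump 0 d + m) i m.
  by move=> _; rewrite ddiff_mon_diff (addnS d).
rewrite -(telescope_sumr_eq (fun i => ddiff_mon t (bump 0 d + m) i m) _
  (ltnW ab) row).
rewrite (big_nat_widen _ _ _ _ _ bM) (big_nat_widenl _ 0%N) // big_mkord.
by apply: eq_bigl => i; rewrite /gap /= andbC.
Qed.

Lemma gap_incr r (J : 'I_r.+1 -> nat) (I : {ffun 'I_r -> 'I_(J ord_max)}) :
  (forall a b : 'I_r.+1, (a < b)%N -> (J a < J b)%N) ->
  I \in family (gap J) ->
  forall a b : 'I_r, (a < b)%N -> (I a < I b)%N.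
Proof.
move=> Jinc /familyP IJ a b ab.
have /andP[_ Ia] := IJ a; have /andP[Ib _] := IJ b.
apply: leq_trans Ia (leq_trans _ Ib).
have [e|ne] := eqVneq (val (lift ord0 a)) (val (widen_ord (leqnSn r) b)).
  by rewrite (val_inj e).
by apply/ltnW/Jinc; move: ne; rewrite /= /bump /=; lia.
Qed.

Lemma det_moment_ge0 r (J : 'I_r -> nat) m :
  (forall a b : 'I_r, (a < b)%N -> (J a < J b)%N) -> 0 <= \det (moment_mx J m).
Proof.
elim: r J m => [|r IH] J m Jinc; first by rewrite det_mx00.
rewrite det_moment_rec //; apply: sumr_ge0 => I IJ; apply: mulr_ge0.
  by apply: prodr_ge0 => l _; rewrite subr_ge0 t_mono // leq_addr.
exact: IH (gap_incr Jinc IJ).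
Qed.

(** Of all selections in the recursion, [I l = J l] keeps the nondegeneracy
    [t (J l) < t (J l + m)], hence has positive weight and positive determinant;
    the others contribute nonnegatively. *)
Lemma det_moment_gt0 r (J : 'I_r -> nat) m :
  (forall a b : 'I_r, (a < b)%N -> (J a < J b)%N) ->
  (forall l, t (J l) < t (J l + m)%N) ->
  0 < \det (moment_mx J m).
Proof.
elim: r J m => [|r IH] J m Jinc Jt; first by rewrite det_mx00.
have Jlt l : (J (widen_ord (leqnSn r) l) < J ord_max)%N.
  by apply: Jinc => /=.
pose I : {ffun 'I_r -> 'I_(J ord_max)} := [ffun l => Ordinal (Jlt l)].
have IJ : I \in family (gap J).
  apply/familyP => l; rewrite ffunE unfold_in /= leqnn /=.
  by apply: Jinc; rewrite /= /bump /=; lia.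
have tI l : t (I l) < t (I l + m.+1)%N.
  rewrite ffunE /=; apply: lt_le_trans (Jt _) (t_mono _).
  by rewrite leq_add2l.
rewrite det_moment_rec // (bigD1 I) //=; apply: ltr_pwDl.
  apply: mulr_gt0; first by apply: prodr_gt0 => l _; rewrite subr_gt0.
  exact: IH (gap_incr Jinc IJ) tI.
apply: sumr_ge0 => I' /andP[IJ' _]; apply: mulr_ge0.
  by apply: prodr_ge0 => l _; rewrite subr_ge0 t_mono // leq_addr.
exact: det_moment_ge0 (gap_incr Jinc IJ').
Qed.

End Determinant.

(** * Divided differences of smooth and truncated functions *)

Section MomentOfBspline.
Context {R : realType}.
Implicit Types (t s : nat -> R) (D E : nat -> R -> R) (f g : R -> R).
Local Notation mu := (@lebesgue_measure R).
Local Open Scope classical_set_scope.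

(** The recursion of [ddiff] only uses the normalized derivatives of the function
    at the knots. Taking them as data [D e y], standing for [g^(e)(y) / e!], makes
    the divided difference linear in data that may depend on a parameter, and
    separates it from the existence of derivatives. *)
Fixpoint hermite_dd t (i m : nat) D : R :=
  match m with
  | 0 => D 0%N (t i)
  | m'.+1 =>
    if t i == t (i + m)%N then D m (t i)
    else (hermite_dd t i.+1 m' D - hermite_dd t i m' D) / (t (i + m)%N - t i)
  end.

Lemma ddiffE t i m g :
  ddiff t i m g = hermite_dd t i m (fun e y => derive1n e g y / e`!%:R).
Proof.
by elim: m i => [|m IH] i /=; [rewrite fact0 divr1 | rewrite !IH].
Qed.

Lemma eq_hermite_dd t s i m D E :
  (forall j, (i <= j <= i + m)%N -> t j = s j) ->
  (forall e j, (e <= m)%N -> (i <= j <= i + m)%N -> D e (t j) = E e (t j)) ->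
  hermite_dd t i m D = hermite_dd s i m E.
Proof.
elim: m i => [|m IH] i ts DE /=.
  by rewrite -ts ?DE // addn0 leqnn.
rewrite -!ts ?leqnn ?leq_addr // DE ?leqnn ?leq_addr //.
congr (if _ then _ else (_ - _) / _); apply: IH => [j ij|e j em ij];
  by [apply: ts; lia | apply: DE; lia].
Qed.

Lemma hermite_dd0 t i m : hermite_dd t i m (fun _ _ => 0) = 0.
Proof. by elim: m i => [|m IH] i //=; rewrite !IH subrr mul0r; case: ifP. Qed.

(** The data are the normalized derivatives of [(y - x) ^+ N]. *)
Lemma hermite_dd_pow t x N i m :
  (forall a b, (a <= b)%N -> t a <= t b) ->
  hermite_dd t i m (fun e y => 'C(N, e)%:R * (y - x) ^+ (N - e))
  = ddiff_mon (fun j => t j - x) N i m.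
Proof.
move=> t_mono; elim: m i => [|m IH] i /=.
  by rewrite bin0 subn0 mul1r ddiff_mon0.
case: eqP => [tt|/eqP tt].
  rewrite (@ddiff_mon_const _ _ N i m.+1 (t i - x)) // => j ij; congr (_ - _).
  by apply/eqP; rewrite eq_le {1}tt !t_mono //; lia.
rewrite !IH ddiff_mon_diff opprD opprK addrACA addNr addr0 mulrAC mulfV ?mul1r //.
by rewrite subr_eq0 eq_sym.
Qed.

(** Integrability and value are carried together, so that linear combinations of
    integrals need no separate integrability bookkeeping. *)
Definition has_integral f (v : R) : Prop :=
  mu.-integrable setT (EFin \o f) /\ (\int[mu]_x f x = v)%R.

Lemma eq_has_integral f g v : f =1 g -> has_integral f v -> has_integral g v.
Proof. by move=> /funext ->. Qed.

Lemma has_integral0 : has_integral (fun=> 0) 0.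
Proof.
split; first exact: integrable0.
by rewrite (Rintegral_cst _ measurableT) mul0r.
Qed.

Lemma has_integralD f g u v :
  has_integral f u -> has_integral g v -> has_integral (fun x => f x + g x) (u + v).
Proof.
move=> [fi <-] [gi <-]; split; last exact: RintegralD.
by rewrite (_ : _ \o _ = (EFin \o f) \+ (EFin \o g))%E //; exact: integrableD.
Qed.

Lemma has_integralZ a f v :
  has_integral f v -> has_integral (fun x => a * f x) (a * v).
Proof.
move=> [fi <-]; split; last exact: RintegralZl.
by rewrite (_ : _ \o _ = (fun x => a%:E * (EFin \o f) x)%E) //; exact: integrableZl.
Qed.

Lemma has_integral_sum r (f : 'I_r -> R -> R) (v : 'I_r -> R) :
  (forall l, has_integral (f l) (v l)) ->
  has_integral (fun x => \sum_l f l x) (\sum_l v l).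
Proof.
elim: r f v => [|r IH] f v fv.
  rewrite big_ord0; apply: eq_has_integral has_integral0 => x.
  by rewrite big_ord0.
rewrite big_ord_recl; apply: eq_has_integral (has_integralD (fv ord0)
  (IH _ _ (fun l => fv (lift ord0 l)))) => x.
by rewrite big_ord_recl.
Qed.

(** A divided difference is a finite linear combination of its data, so it
    commutes with integration. The data of top order [m] enter only if all knots
    coincide; this exempts the derivative of order [k + 1] of a truncated power
    of degree [k], whose integral would not be the derivative of the integral. *)
Lemma has_integral_hermite_dd t i m (phi : R -> R) (D : R -> nat -> R -> R) E :
  (forall e j, (e <= m)%N -> (i <= j <= i + m)%N ->
    (e < m)%N || (t i == t (i + m)%N) ->
    has_integral (fun x => D x e (t j) * phi x) (E e (t j))) ->
  has_integral (fun x => hermite_dd t i m (D x) * phi x) (hermite_dd t i m E).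
Proof.
elim: m i => [|m IH] i DE /=; first by apply: DE; rewrite ?addn0 ?leqnn ?eqxx.
case: ifP => tt; first by apply: DE; rewrite ?leqnn ?leq_addr ?tt ?orbT.
set w := _ - t i.
rewrite [X in has_integral _ X](_ : _ = w^-1 * (hermite_dd t i.+1 m E
  + (-1) * hermite_dd t i m E)); last by ring.
apply: (eq_has_integral (f := fun x => w^-1 * (hermite_dd t i.+1 m (D x) * phi x
  + (-1) * (hermite_dd t i m (D x) * phi x)))) => [x|]; first by ring.
apply/has_integralZ/has_integralD; last apply: has_integralZ.
  by apply: IH => e j em ij _; apply: DE; lia.
by apply: IH => e j em ij _; apply: DE; lia.
Qed.

Lemma measurable_fun_finite_support (s : seq R) f :
  (forall x, x \notin s -> f x = 0) -> measurable_fun setT f.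
Proof.
elim: s f => [|a s IH] f f0.
  by rewrite (_ : f = cst 0) //; apply/funext => x; apply: f0.
rewrite (_ : f = fun x => if x == a then f a else (if x == a then 0 else f x)).
  apply: measurable_fun_ifT.
  - apply: (measurable_fun_bool true); rewrite setTI.
    rewrite (_ : _ @^-1` _ = [set a]%classic) //.
    by apply/seteqP; split => x /= /eqP.
  - exact: measurable_cst.
  - apply: IH => x xs; case: eqP => // /eqP xa; apply: f0.
    by rewrite inE negb_or xa.
by apply/funext => x; case: eqP => [->|].
Qed.

Lemma has_integral_finite_support (s : seq R) f :
  (forall x, x \notin s -> f x = 0) -> has_integral f 0.
Proof.
move=> f0.
have mf : measurable_fun setT (EFin \o f).
  by apply/measurable_EFinP; exact: (measurable_fun_finite_support f0).
have ae0 : ae_eq mu setT (EFin \o f) (cst 0%E).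
  exists [set` s]; split.
  - apply: countable_measurable => [x|]; first exact: measurable_set1.
    exact/finite_set_countable/finite_seq.
  - by apply: countable_lebesgue_measure0; exact/finite_set_countable/finite_seq.
  - move=> x /= /not_implyP[_ fx]; apply: contrapT => /negP /f0 e.
    by apply: fx; rewrite e.
split; last first.
  by rewrite /Rintegral (ae_eq_integral (cst 0%E)) // integral0.
apply/integrableP; split => //.
rewrite (ae_eq_integral (cst 0%E)) ?integral0 //.
  exact: measurableT_comp.
by move: ae0; apply: filterS => x /= e xT; case: (e xT) => ->; rewrite normr0.
Qed.

Lemma has_integral_off_finite (s : seq R) f g v :
  (forall x, x \notin s -> f x = g x) -> has_integral g v -> has_integral f v.
Proof.
move=> fg gv; have d0 : has_integral (fun x => f x - g x) 0.
  by apply: (has_integral_finite_support (s := s)) => x /fg ->; rewrite subrr.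
rewrite -[v]addr0; apply: eq_has_integral (has_integralD gv d0) => x.
by rewrite addrC subrK.
Qed.

Lemma has_integral_deriv_poly (p : {poly R}) (a b : R) : a < b ->
  has_integral (fun x => if a <= x <= b then p^`().[x] else 0) (p.[b] - p.[a]).
Proof.
move=> ab.
have E : (fun x => if a <= x <= b then p^`().[x] else 0)
    = (fun x => p^`().[x]) \_ `[a, b]%classic.
  apply/funext => x; rewrite patchE.
  have -> : (x \in `[a, b]%classic) = (a <= x <= b).
    by apply/idP/idP; rewrite inE /= in_itv.
  by [].
rewrite E; split.
  have mkcond := @integrable_mkcond _ _ _ mu `[a, b] (EFin \o horner p^`())
    (measurable_itv _).
  rewrite -restrict_EFin; apply mkcond.
  apply: continuous_compact_integrable; first exact: segment_compact.
  by apply: continuous_subspaceT => x; exact: continuous_horner.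
rewrite -Rintegral_mkcond /Rintegral (continuous_FTC2 (F := horner p)) //.
- by apply: continuous_subspaceT => x; exact: continuous_horner.
- split => /=.
  + by move=> x _; exact: derivable_horner.
  + by apply: cvg_at_right_filter; exact: continuous_horner.
  + by apply: cvg_at_left_filter; exact: continuous_horner.
- by move=> x _; rewrite derive1E; exact: derive_val.
Qed.

(** Induction on [j]: integrating the derivative of
    [(b - x) ^+ j.+1 * (x - a) ^+ d.+1], which vanishes at both ends, trades a
    factor [b - x] for a factor [x - a]. *)
Lemma has_integral_beta (a b : R) j d : a < b ->
  has_integral (fun x => if a <= x <= b then (b - x) ^+ j * (x - a) ^+ d else 0)
    (j`!%:R * d`!%:R / (j + d).+1`!%:R * (b - a) ^+ (j + d).+1).
Proof.
move=> ab; elim: j d => [|j IH] d.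
  have P := has_integral_deriv_poly (d.+1%:R^-1 *: ('X - a%:P) ^+ d.+1) ab.
  rewrite !hornerE subrr expr0n /= mulr0 subr0 in P.
  rewrite fact0 mul1r add0n factS natrM invfM mulrCA mulfV ?mulr1; last first.
    by rewrite pnatr_eq0 -lt0n fact_gt0.
  move: P; apply: eq_has_integral => x; case: ifP => // _.
  rewrite derivZ deriv_exp derivXsubC mul1r /= expr0 mul1r hornerZ hornerMn !hornerE.
  by rewrite -[X in _ * X]mulr_natl mulKf ?pnatr_eq0.
have P := has_integral_deriv_poly ((b%:P - 'X) ^+ j.+1 * ('X - a%:P) ^+ d.+1) ab.
rewrite !hornerE !subrr !expr0n /= mulr0 mul0r subrr in P.
have Q := has_integralZ (d.+1%:R^-1)
  (has_integralD P (has_integralZ (j.+1%:R) (IH d.+1))).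
have d0 : d.+1%:R != 0 :> R by rewrite pnatr_eq0.
rewrite [X in has_integral _ X](_ : _ = d.+1%:R^-1 * (0 + j.+1%:R *
  (j`!%:R * d.+1`!%:R / (j + d.+1).+1`!%:R * (b - a) ^+ (j + d.+1).+1))); last first.
  rewrite add0r addSnnS !factS !natrM.
  have g0 : (j + d.+1).+1%:R != 0 :> R by rewrite pnatr_eq0.
  have g1 : (j + d.+1)`!%:R != 0 :> R by rewrite pnatr_eq0 -lt0n fact_gt0.
  move: d0 g0 g1.
  move: (d.+1%:R) ((j + d.+1).+1%:R) ((j + d.+1)`!%:R) => D G H d0 g0 g1.
  by field; rewrite d0 g0 g1.
apply: eq_has_integral Q => x; case: ifP => _; last by rewrite mulr0 addr0 mulr0.
suff -> : ((b%:P - 'X) ^+ j.+1 * ('X - a%:P) ^+ d.+1)^`().[x]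
    = d.+1%:R * ((b - x) ^+ j.+1 * (x - a) ^+ d)
      - j.+1%:R * ((b - x) ^+ j * (x - a) ^+ d.+1).
  by rewrite subrK mulKf.
rewrite derivM !deriv_exp derivXsubC derivB derivC derivX /= mul1r sub0r mulN1r.
rewrite hornerD !hornerM !hornerMn hornerN !horner_exp !hornerE.
rewrite /= addrC mulrnAr -mulr_natl mulrA; congr (_ + _).
by rewrite mulNrn mulNr -[X in X * _]mulr_natl.
Qed.

(** * Moments of B-splines *)

Lemma derive1n_tpow_gt k (x y : R) m : x < y ->
  derive1n m (fun z => tpow k (z - x)) y = (k ^_ m)%:R * (y - x) ^+ (k - m).
Proof.
elim: m y => [|m IH] y xy.
  by rewrite derive1n0 /tpow subr_gt0 xy mul1r subn0.
pose p := (k ^_ m)%:R *: ('X - x%:P) ^+ (k - m).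
rewrite derive1nS derive1E (near_eq_derive (g := horner p)); last first.
  apply: filterS (lt_nbhsr xy) => z /IH ->.
  by rewrite /p hornerZ horner_exp !hornerE.
rewrite derive_val derivZ deriv_exp derivXsubC mul1r hornerZ hornerMn !hornerE.
by rewrite ffactnSr natrM -mulrA [(k - m)%:R * _]mulr_natl subnS.
Qed.

Lemma derive1n_tpow_lt k (x y : R) m : y < x ->
  derive1n m (fun z => tpow k (z - x)) y = 0.
Proof.
elim: m y => [|m IH] y xy.
  by rewrite derive1n0 /tpow subr_gt0 ltNge (ltW xy).
rewrite derive1nS derive1E (near_eq_derive (g := cst 0)) ?derive_cst //.
by apply: filterS (lt_nbhsl xy) => z /IH ->.
Qed.

Lemma taylor_tpow k (x y : R) e : x != y ->
  derive1n e (fun z => tpow k (z - x)) y / e`!%:R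
  = if x <= y then 'C(k, e)%:R * (y - x) ^+ (k - e) else 0.
Proof.
case: ltgtP => // [xy|yx] _.
  by rewrite derive1n_tpow_gt // -bin_ffact natrM mulrAC mulfK //.
by rewrite derive1n_tpow_lt // mul0r.
Qed.

(** The data of [y |-> tpow k (y - x)], cut off to 0 for [x < a]. Without the
    cut-off their integrals over [x] would diverge at [-oo]; with it they are beta
    integrals. *)
Definition truncated_taylor k (a x : R) (e : nat) (y : R) : R :=
  if a <= x <= y then 'C(k, e)%:R * (y - x) ^+ (k - e) else 0.

(** The cut-off does not change the divided difference of order [k + 1]: for
    [x < a] the truncated power is a polynomial of degree [k] around all the
    knots, and its divided difference vanishes. The knots themselves are excluded
    because the truncated power need not be differentiable there. *)
Lemma bspline_off_knots k s i (a x : R) :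
  (forall p q, (p <= q)%N -> s p <= s q) -> (forall j, a < s j) ->
  x \notin [seq s j | j <- iota i k.+2] ->
  bspline k s i x = k.+1%:R * hermite_dd s i k.+1 (truncated_taylor k a x).
Proof.
move=> s_mono a_lt_s xs; rewrite /bspline ddiffE; congr (_ * _).
have taylor e j : (i <= j <= i + k.+1)%N ->
    derive1n e (fun z => tpow k (z - x)) (s j) / e`!%:R
    = if x <= s j then 'C(k, e)%:R * (s j - x) ^+ (k - e) else 0.
  move=> ij; apply: taylor_tpow; apply: contra xs => /eqP ->.
  by apply: map_f; rewrite mem_iota; lia.
have [ax|xa] := leP a x.
  apply: eq_hermite_dd => // e j _ ij.
  by rewrite taylor // /truncated_taylor ax.
rewrite (@eq_hermite_dd s s i k.+1 _
  (fun e y => 'C(k, e)%:R * (y - x) ^+ (k - e))) //.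
  rewrite hermite_dd_pow // ddiff_mon_small // -(hermite_dd0 s i k.+1).
  apply: eq_hermite_dd => // e j _ _.
  by rewrite /truncated_taylor leNgt xa.
move=> e j _ ij; rewrite taylor //.
by rewrite (ltW (lt_trans xa (a_lt_s j))).
Qed.

(** Integrating the truncated power in [x] against [(x - a) ^+ d] gives a multiple
    of [(y - a) ^+ (d + k.+1)], with no terms of lower degree because [a] lies
    below the knots; the divided difference is then applied to that power. *)
Lemma bspline_moment k s i (a : R) d :
  (forall p q, (p <= q)%N -> s p <= s q) -> (forall j, a < s j) ->
  s i < s (i + k + 1)%N ->
  has_integral (fun x => bspline k s i x * (x - a) ^+ d)
    ('C(d + k.+1, d)%:R^-1 * ddiff_mon (fun j => s j - a) (d + k.+1) i k.+1).
Proof.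
move=> s_mono a_lt_s si.
have fact_neq0 q : q`!%:R != 0 :> R by rewrite pnatr_eq0 -lt0n fact_gt0.
(* By the beta integral, [w] is the ratio between the integral of
   [(y - x)_+ ^ k * (x - a) ^ d] over [x >= a] and [(y - a) ^ (d + k + 1)]. *)
pose w : R := k`!%:R * d`!%:R / (d + k.+1)`!%:R.
have w0 : w != 0 by rewrite !mulf_neq0 ?invr_neq0.
have wE : 'C(d + k.+1, d)%:R^-1 = k.+1%:R * w :> R.
  have := congr1 (fun q => q%:R : R) (bin_fact (leq_addr k.+1 d)).
  rewrite addKn factS !natrM /w => <-.
  have c0 : 'C(d + k.+1, d)%:R != 0 :> R.
    by rewrite pnatr_eq0 -lt0n bin_gt0 leq_addr.
  have k0 : k.+1%:R != 0 :> R by rewrite pnatr_eq0.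
  move: (fact_neq0 k) (fact_neq0 d) c0 k0.
  move: (k`!%:R) (d`!%:R) ('C(_, _)%:R) (k.+1%:R) => K D B C K0 D0 B0 C0.
  by field; rewrite K0 D0 B0 C0.
have H : has_integral
    (fun x => hermite_dd s i k.+1 (truncated_taylor k a x) * (w^-1 * (x - a) ^+ d))
    (ddiff_mon (fun j => s j - a) (d + k.+1) i k.+1).
  rewrite -hermite_dd_pow //; apply: has_integral_hermite_dd => e j _ _ ek.
  have {}ek : (e <= k)%N.
    case/orP: ek => // /eqP ss; move: si.
    by rewrite ss addn1 addnS ltxx.
  have := has_integralZ (w^-1 * 'C(k, e)%:R) (has_integral_beta (k - e) d (a_lt_s j)).
  rewrite [X in has_integral _ X](_ : _ =
    'C(d + k.+1, e)%:R * (s j - a) ^+ (d + k.+1 - e)).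
    apply: eq_has_integral => x; rewrite /truncated_taylor.
    case: ifP => _; last by rewrite mulr0 mul0r.
    by rewrite [w^-1 * _]mulrC -!mulrA; congr (_ * _); rewrite mulrCA.
  have -> : (k - e + d).+1 = (d + k.+1 - e)%N by lia.
  rewrite mulrA; congr (_ * _).
  have E1 := congr1 (fun q => q%:R : R) (bin_fact ek).
  have eN : (e <= d + k.+1)%N by lia.
  have E2 := congr1 (fun q => q%:R : R) (bin_fact eN).
  rewrite /= !natrM in E1 E2; rewrite /w -E1 -E2.
  have c0 : 'C(d + k.+1, e)%:R != 0 :> R by rewrite pnatr_eq0 -lt0n bin_gt0.
  have b0 : 'C(k, e)%:R != 0 :> R by rewrite pnatr_eq0 -lt0n bin_gt0.
  move: (fact_neq0 e) (fact_neq0 d) (fact_neq0 (k - e)%N).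
  move: (fact_neq0 (d + k.+1 - e)%N) c0 b0.
  move: (e`!%:R) (d`!%:R) ((k - e)`!%:R) ((d + k.+1 - e)`!%:R).
  move: ('C(_, _)%:R) ('C(_, _)%:R).
  move=> x1 x2 x3 x4 x5 x6 y1 y2 y3 y4 y5 y6.
  by field; rewrite ?y1 ?y2 ?y3 ?y4 ?y5 ?y6.
rewrite wE -mulrA.
have := has_integralZ k.+1%:R (has_integralZ w H).
apply: (has_integral_off_finite (s := [seq s j | j <- iota i k.+2])) => x xs.
rewrite (bspline_off_knots s_mono a_lt_s xs) -mulrA; congr (_ * _).
by rewrite mulrCA mulVKf.
Qed.

Lemma eq_bspline k t s i : (forall j, (i <= j <= i + k.+1)%N -> t j = s j) ->
  bspline k t i =1 bspline k s i.
Proof.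
move=> ts x; rewrite /bspline !ddiffE; congr (_ * _).
exact: eq_hermite_dd.
Qed.

End MomentOfBspline.

(** * The linear system for the coefficients *)

(** Here [u] are the rational knots. The condition of degree [d] is used only at
    the abscissa [A = h * a + xi], where the moments of the B-splines are explicit
    and, by homogeneity, equal to [h ^+ d] times rational numbers. *)
Lemma siac_linear_system (R : realType) (k r : nat) (J : 'I_r.+1 -> nat)
   (t : nat -> R) (u : nat -> rat) (a : rat) (h xi : R) (c : 'I_r.+1 -> R) :
  (forall p q, (p <= q)%N -> u p <= u q) -> (forall j, a < u j) ->
  (forall l, u (J l) < u (J l + k + 1)%N) -> 0 < h ->
  (forall l j, (J l <= j <= J l + k.+1)%N -> t j = ratr (u j)) ->
  siac_coefficients k J (fun i => h * t i + xi) c ->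
  forall d : 'I_r.+1,
   \sum_l c l * ratr (moment_mx (fun j => u j - a) J k.+1 l d)
   = 'C(d + k.+1, d)%:R * (- (xi * h^-1) - ratr a) ^+ d.
Proof.
move=> u_mono au uJ h0 tu siac d.
have h_neq0 : h != 0 by rewrite gt_eqF.
pose A : R := h * ratr a + xi.
pose s j : R := h * ratr (u j) + xi.
have s_mono p q : (p <= q)%N -> s p <= s q.
  by move=> pq; rewrite lerD2r ler_pM2l // ler_rat u_mono.
have As j : A < s j by rewrite ltrD2r ltr_pM2l // ltr_rat.
have sJ l : s (J l) < s (J l + k + 1)%N by rewrite ltrD2r ltr_pM2l // ltr_rat.
have dr : (d <= r)%N by rewrite -ltnS.
have I := has_integral_sum (fun l =>
  has_integralZ (c l) (bspline_moment d s_mono As (sJ l))).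
have C := siac d dr A; rewrite /convolution in C.
have E : \sum_l c l * ('C(d + k.+1, d)%:R^-1
    * ddiff_mon (fun j => s j - A) (d + k.+1) (J l) k.+1) = (- A) ^+ d.
  rewrite -C -I.2; apply: eq_Rintegral => x _.
  rewrite /siac_spline mulr_suml opprB; apply: eq_bigr => l _; rewrite -mulrA.
  congr (_ * (_ * _)); apply/esym/eq_bspline => j jl.
  by rewrite /s (tu l).
have B0 : 'C(d + k.+1, d)%:R != 0 :> R.
  by rewrite pnatr_eq0 -lt0n bin_gt0 leq_addr.
apply: (mulfI (expf_neq0 d h_neq0)); apply: (mulfI (invr_neq0 B0)).
rewrite [RHS]mulrCA mulKf // -exprMn.
have -> : h * (- (xi * h^-1) - ratr a) = - A by rewrite /A; field.
rewrite -E !mulr_sumr; apply: eq_bigr => l _.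
have scale : ddiff_mon (fun j => s j - A) (d + k.+1) (J l) k.+1
    = h ^+ d * ratr (ddiff_mon (fun j => u j - a) (d + k.+1) (J l) k.+1).
  apply: (mulfI (expf_neq0 k.+1 h_neq0)).
  rewrite ddiff_mon_morph mulrA -exprD addnC -ddiff_mon_scale.
  congr (_ * ddiff_mon _ _ _ _).
  by apply/funext => j /=; rewrite /s /A rmorphB /=; ring.
by rewrite scale mxE; ring.
Qed.

Theorem corollary3p1 (R : realType) (k r n : nat) (J : 'I_r.+1 -> nat)
    (t : nat -> R)
    (J0 : J ord0 = 0%N)
    (J_incr : forall a b : 'I_r.+1, (a < b)%N -> (J a < J b)%N)
    (n_def : n = (J ord_max + k + 1)%N)
    (t_nondecr : forall i j : nat, (i <= j)%N -> (j <= n)%N -> t i <= t j)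
    (t_J : forall l : 'I_r.+1, t (J l) < t (J l + k + 1)%N)
    (t_rat : forall i : nat, (i <= n)%N -> exists q : rat, t i = ratr q) :
  exists P : 'I_r.+1 -> {poly {poly rat}},
    forall (h xi : R), 0 < h ->
    forall c : 'I_r.+1 -> R,
      siac_coefficients k J (fun i => h * t i + xi) c ->
      forall l : 'I_r.+1, c l = ratpoly2_eval (P l) xi h^-1.
Proof.
have /boolp.choice[q tq] : forall i, exists y : rat, (i <= n)%N -> t i = ratr y.
  by move=> i; have [/t_rat[y ty]|] := leqP i n; [exists y|exists 0].
(* Freezing the knots after [t n] makes the sequence monotone on all of [nat]. *)
pose u i := q (minn i n).
have tu i : (i <= n)%N -> t i = ratr (u i).
  by move=> i_n; rewrite /u (minn_idPl i_n) tq.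
have u_mono i j : (i <= j)%N -> u i <= u j.
  move=> ij; rewrite -(ler_rat R) -!tq ?geq_minr //.
  by apply: t_nondecr; rewrite ?geq_minr //; lia.
have JM l : (J l + k + 1 <= n)%N.
  rewrite n_def !leq_add2r; have [->//|lM] := eqVneq l ord_max.
  by apply/ltnW/J_incr; rewrite ltn_neqAle leq_ord andbT.
have uJ l : u (J l) < u (J l + k + 1)%N.
  by rewrite -(ltr_rat R) -!tu //; apply: leq_trans (JM l); lia.
have [a au] : exists a, forall j, a < u j.
  exists (u 0%N - 1) => j.
  by rewrite ltrBlDr (le_lt_trans (u_mono 0%N j _)) // ltrDl.
pose M := moment_mx (fun j => u j - a) J k.+1.
have M_unit : M \in unitmx.
  rewrite unitmxE unitfE gt_eqF //; apply: det_moment_gt0 => // [i j ij|l].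
    by rewrite lerD2r u_mono.
  by rewrite ltrD2r -addn1 addnA.
exists (fun l => \sum_(d < r.+1) ('C(d + k.+1, d)%:R *
  (- ('X * 'X%:P) - a%:P%:P) ^+ d * (invmx M d l)%:P%:P)).
move=> h xi h0 c siac l.
have tJ l' j : (J l' <= j <= J l' + k.+1)%N -> t j = ratr (u j).
  by move=> /andP[_ jl]; apply: tu; apply: leq_trans jl _; rewrite -addn1 addnA.
have E := siac_linear_system u_mono au uJ h0 tJ siac.
pose cv : 'rV[R]_r.+1 := \row_l c l.
pose v : 'rV[R]_r.+1 := \row_d ('C(d + k.+1, d)%:R * (- (xi * h^-1) - ratr a) ^+ d).
have cvM : cv *m map_mx ratr M = v.
  apply/rowP => d; rewrite !mxE -E; apply: eq_bigr => j _.
  by rewrite !mxE.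
have cvE : cv = v *m map_mx ratr (invmx M).
  by rewrite -cvM -mulmxA -map_mxM mulmxV // map_mx1 mulmx1.
have -> : c l = cv 0 l by rewrite mxE.
rewrite cvE mxE /ratpoly2_eval rmorph_sum !horner_sum; apply: eq_bigr => d _.
rewrite !mxE !rmorphM rmorphXn rmorphB rmorphN rmorphM rmorph_nat /=.
rewrite !map_polyC /= !map_polyC /= map_polyX map_polyX.
rewrite !hornerM !horner_exp !(hornerD, hornerN) !hornerM !hornerMn.
rewrite !hornerX !hornerC.
by rewrite hornerX.
Qed.
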